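(* The real and complex Tsirelson correlation sets coincide: for all $n,m,k\in\mathbb{N}$, $C_{qc}^{\mathbb{R}}(n,m,k)=C_{qc}(n,m,k)$ and $C_{q}^{\mathbb{R}}(n,m,k)=C_{q}(n,m,k)$.
   Context: Write $[N]=\{1,\dots,N\}$. A correlation is a tuple of nonnegative real numbers $\{p(\vec a|\vec b):\vec a\in[n]^k,\vec b\in[m]^k\}$. $C_{qc}(n,m,k)$ is the set of correlations $p$ for which there exist a unital complex C$^*$-algebra $A$; for each $i\in[k]$ and each $b\in[m]$ a projection-valued measure $\{P_a^b(i)\}_{a=1}^n$ in $A$ (selfadjoint projections summing over $a$ to $1$) such that $P_a^b(i)$ and $P_{a'}^{b'}(j)$ commute whenever $i\neq j$; and a state $\varphi:A\to\mathbb{C}$ with $p(\vec a|\vec b)=\varphi\big(\prod_{i=1}^kP_{a_i}^{b_i}(i)\big)$ for all $\vec a,\vec b$. $C_q(n,m,k)$ is defined in the same way with $A$ required to be finite dimensional. $C_{qc}^{\mathbb{R}}(n,m,k)$ and $C_q^{\mathbb{R}}(n,m,k)$ are defined in the same way but with $A$ a unital real C$^*$-algebra (a norm closed real $*$-subalgebra of $B(H)$, $H$ a real Hilbert space), respectively a finite dimensional one, and $\varphi:A\to\mathbb{R}$ a real state (unital, positive, real linear with $\varphi(x^* )=\varphi(x)$). *)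

(* Defs.v *)
From HB Require Import structures.
From mathcomp Require Import all_boot all_order all_algebra.
From mathcomp Require Import sesquilinear complex.
From mathcomp Require Import all_classical all_reals all_analysis.

Set Implicit Arguments.
Unset Strict Implicit.
Unset Printing Implicit Defensive.

Import Order.TTheory GRing.Theory Num.Theory.
Import numFieldNormedType.Exports.

Local Open Scope classical_set_scope.
Local Open Scope ring_scope.
Local Open Scope complex_scope.

(* Unital *-algebras over K, where theta is the conjugation of scalars
   (idfun for real algebras, complex conjugation for complex ones).
   The inherited axiom 1 != 0 only rules out the zero algebra, which carries
   no state. *)
HB.mixin Record Algebra_isStar (K : numFieldType) (theta : K -> K) A
    of GRing.Algebra K A := {
  star : A -> A ;
  starK : involutive star ;
  starD : {morph star : x y / x + y} ;
  starZ : forall (c : K) (x : A), star (c *: x) = theta c *: star x ;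
  starM : forall x y : A, star (x * y) = star y * star x
}.

#[short(type="starAlgType")]
HB.structure Definition StarAlgebra (K : numFieldType) (theta : K -> K) :=
  {A of GRing.Algebra K A & Algebra_isStar K theta A}.

Notation realStarAlgType R := (starAlgType (@idfun R)).
Notation complexStarAlgType R := (starAlgType (@Num.conj R[i])).

(* The norm is an explicit function because the library has no structure
   joining algebras and normed modules other than number domains. It is
   R-valued, whereas `|c| for c : R[i] lies in R[i], hence the casts %:C.
   A C*-norm on a given *-algebra is unique. *)
Record cstar_norm (R : realType) (A : complexStarAlgType R)
    (N : A -> R) : Prop := {
  cnorm_eq0 : forall x, N x = 0 -> x = 0 ;
  cnormD : forall x y, N (x + y) <= N x + N y ;
  cnormZ : forall c x, (N (c *: x))%:C = `|c| * (N x)%:C ;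
  cnormM : forall x y, N (x * y) <= N x * N y ;
  cnorm_star : forall x, N (star x * x) = N x ^+ 2 ;
  cnorm_complete : forall u : nat -> A,
    (forall e : R, 0 < e -> exists n0 : nat, forall i j : nat,
       (n0 <= i)%N -> (n0 <= j)%N -> N (u i - u j) < e) ->
    exists l : A, forall e : R, 0 < e -> exists n0 : nat, forall i : nat,
       (n0 <= i)%N -> N (u i - l) < e
}.

Definition is_cstar (R : realType) (A : complexStarAlgType R) : Prop :=
  exists N : A -> R, cstar_norm N.

Record realHilbert (R : realType) := RealHilbert {
  hilbert_sort :> completeNormedModType R ;
  inner : {dot hilbert_sort for idfun} ;
  inner_norm : forall u, inner u u = `|u| ^+ 2
}.

(* pi identifies A with a norm closed *-subalgebra of the bounded operators
   on H; the unit of the subalgebra need not be the identity of H. *)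
Record closed_operator_algebra (R : realType) (A : realStarAlgType R)
    (H : realHilbert R) (pi : A -> {linear H -> H}) : Prop := {
  op_bounded : forall a, continuous (pi a) ;
  op_linear : forall c a b x, pi (c *: a + b) x = c *: pi a x + pi b x ;
  op_mul : forall a b x, pi (a * b) x = pi a (pi b x) ;
  op_star : forall a x y, inner H (pi a x) y = inner H x (pi (star a) y) ;
  op_inj : forall a b, pi a =1 pi b -> a = b ;
  op_closed : forall T : {linear H -> H}, continuous T ->
    (forall e : R, 0 < e ->
       exists a, forall x, `|T x - pi a x| <= e * `|x|) ->
    exists a, pi a =1 T
}.

Definition is_real_cstar (R : realType) (A : realStarAlgType R) : Prop :=
  exists (H : realHilbert R) (pi : A -> {linear H -> H}),
    closed_operator_algebra pi.

Definition finite_dimensional (K : numFieldType) (V : lmodType K) : Prop :=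
  exists (d : nat) (e : 'I_d -> V),
    forall x, exists c : 'I_d -> K, x = \sum_(i < d) c i *: e i.

Section StarAlgebraNotions.
Variables (K : numFieldType) (theta : K -> K) (A : starAlgType theta).

Definition is_projection (x : A) : Prop := star x = x /\ x * x = x.

(* [P i b a] is the projection written P_a^b(i). *)
Definition commuting_pvms (n m k : nat) (P : 'I_k -> 'I_m -> 'I_n -> A) : Prop :=
  [/\ forall i b a, is_projection (P i b a),
      forall i b, \sum_(a < n) P i b a = 1
    & forall i j b b' a a', i != j ->
        P i b a * P j b' a' = P j b' a' * P i b a].

(* Over R[i], [0 <= z] says that z is real and nonnegative. *)
Definition is_state (phi : {scalar A}) : Prop :=
  phi 1 = 1 /\ forall x, 0 <= phi (star x * x).

Definition is_real_state (phi : {scalar A}) : Prop :=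
  is_state phi /\ forall x, phi (star x) = phi x.

End StarAlgebraNotions.

Section Correlations.
Variables (R : realType) (n m k : nat).

Definition correlation := {ffun 'I_k -> 'I_n} -> {ffun 'I_k -> 'I_m} -> R.

Definition nonneg_correlation (p : correlation) : Prop :=
  forall a b, 0 <= p a b.

Definition complex_realizes (A : complexStarAlgType R) (p : correlation) : Prop :=
  exists (P : 'I_k -> 'I_m -> 'I_n -> A) (phi : {scalar A}),
    [/\ commuting_pvms P, is_state phi
      & forall a b, (p a b)%:C = phi (\prod_(i < k) P i (b i) (a i))].

Definition real_realizes (A : realStarAlgType R) (p : correlation) : Prop :=
  exists (P : 'I_k -> 'I_m -> 'I_n -> A) (phi : {scalar A}),
    [/\ commuting_pvms P, is_real_state phi
      & forall a b, p a b = phi (\prod_(i < k) P i (b i) (a i))].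

Definition Cqc : set correlation :=
  [set p | nonneg_correlation p /\
     exists A : complexStarAlgType R, is_cstar A /\ complex_realizes A p].

Definition Cq : set correlation :=
  [set p | nonneg_correlation p /\
     exists A : complexStarAlgType R,
       [/\ is_cstar A, finite_dimensional A & complex_realizes A p]].

Definition CqcR : set correlation :=
  [set p | nonneg_correlation p /\
     exists A : realStarAlgType R, is_real_cstar A /\ real_realizes A p].

Definition CqR : set correlation :=
  [set p | nonneg_correlation p /\
     exists A : realStarAlgType R,
       [/\ is_real_cstar A, finite_dimensional A & real_realizes A p]].

End Correlations.

Arguments Cqc : clear implicits.
Arguments Cq : clear implicits.
Arguments CqcR : clear implicits.
Arguments CqR : clear implicits.

(* Main.v *)
(* From real to complex, one replaces a real C*-algebra acting on H by its
   complexification acting on H + iH, and extends the state by linearity.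

   From complex to real, the algebra A need not be embedded in an algebra of
   operators (the Gelfand-Naimark theorem): it suffices to represent the
   projections. The form s(x, y) = Re phi(y^* x) turns A into a real semi-inner
   product space, whose Hilbert completion H is realized as the space of bounded
   functionals on A, which is complete without taking any quotient. Its inner
   product and the density of A in it come from the formula
   |f|^2 = sup_x (2 f(x) - s(x, x)), which for f + s(-, a) gives
   |f + s(-, a)|^2 = |f|^2 + 2 f(a) + s(a, a). Left multiplication by a
   projection p is a contraction, as
   s(p x, p x) + s((1 - p) x, (1 - p) x) = s(x, x), hence acts on H; so the
   correlation is realized in the real C*-algebra of all bounded operators on H,
   by the vector state of 1. *)
Require Import Defs.
From HB Require Import structures.
From mathcomp Require Import all_boot all_order all_algebra.
From mathcomp Require Import sesquilinear complex ring lra.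
From mathcomp Require Import all_classical all_reals all_analysis.

Set Implicit Arguments.
Unset Strict Implicit.
Unset Printing Implicit Defensive.

Import Order.TTheory GRing.Theory Num.Theory.
Import numFieldNormedType.Exports.

Local Open Scope classical_set_scope.
Local Open Scope ring_scope.

(** * Semi-inner products and their duals *)

Section BestConstant.
Variables (R : realType) (T : Type) (F G : T -> R).

Definition bounded_by (C : R) : Prop :=
  0 <= C /\ forall t, F t <= C * G t.

(** With [F] the size of the image and [G] a seminorm this is the operator norm; it serves
    functionals and operators alike. *)
Definition best_constant : R := inf [set C | bounded_by C].

Hypothesis G_ge0 : forall t, 0 <= G t.
Hypothesis FG_bounded : exists C, bounded_by C.

Lemma best_constant_ge0 : 0 <= best_constant.
Proof. by apply: lb_le_inf => // C []. Qed.

Lemma best_constant_le C : bounded_by C -> best_constant <= C.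
Proof. by move=> BC; apply: ge_inf => //; exists 0 => D []. Qed.

(** The infimum is itself admissible: where [G t = 0] any admissible constant forces [F t <= 0], and
    elsewhere [F t / G t] bounds the admissible constants from below. *)
Lemma best_constantP t : F t <= best_constant * G t.
Proof.
have [Gt0|] := eqVneq (G t) 0.
  by case: FG_bounded => C [_ /(_ t)]; rewrite Gt0 !mulr0.
move=> Gt; have {}Gt : 0 < G t by rewrite lt_def Gt G_ge0.
rewrite -ler_pdivrMr//; apply: lb_le_inf => // C [_ /(_ t)].
by rewrite ler_pdivrMr.
Qed.

End BestConstant.

(** Nonzero vectors of length zero are allowed, so that the form given by a state fits without
    passing to a quotient. *)
Record semi_inner (R : realType) (E : lmodType R) := SemiInner {
  semi_form :> E -> E -> R;
  semi_formC : forall x y, semi_form x y = semi_form y x;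
  semi_formP : forall c x y z,
    semi_form (c *: x + y) z = c * semi_form x z + semi_form y z;
  semi_form_ge0 : forall x, 0 <= semi_form x x
}.

(** * The Cauchy-Schwarz inequality *)

Section SemiInnerTheory.
Variables (R : realType) (E : lmodType R) (s : semi_inner E).

Definition seminorm (x : E) : R := Num.sqrt (s x x).

Lemma seminorm_ge0 x : 0 <= seminorm x. Proof. exact: sqrtr_ge0. Qed.

Lemma seminorm_sqr x : seminorm x ^+ 2 = s x x.
Proof. by rewrite sqr_sqrtr// semi_form_ge0. Qed.

Lemma semi_formDl x y z : s (x + y) z = s x z + s y z.
Proof. by have := semi_formP s 1 x y z; rewrite scale1r mul1r. Qed.

Lemma semi_form0l z : s 0 z = 0.
Proof. by apply: (addrI (s 0 z)); rewrite -semi_formDl !addr0. Qed.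

Lemma semi_formZl c x z : s (c *: x) z = c * s x z.
Proof. by rewrite -[c *: x]addr0 semi_formP semi_form0l addr0. Qed.

Lemma semi_formDr x y z : s x (y + z) = s x y + s x z.
Proof. by rewrite ![s x _]semi_formC semi_formDl. Qed.

Lemma semi_formZr c x z : s x (c *: z) = c * s x z.
Proof. by rewrite ![s x _]semi_formC semi_formZl. Qed.

Lemma semi_formNl x z : s (- x) z = - s x z.
Proof. by rewrite -scaleN1r semi_formZl mulN1r. Qed.

Lemma semi_formNr x z : s x (- z) = - s x z.
Proof. by rewrite ![s x _]semi_formC semi_formNl. Qed.

(* The seminorm of a functional is computed by
   [|f|^2 = sup_x (2 f x - |x|^2)]; this is the nontrivial inequality. *)
Lemma functional_bound_sqr (f : E -> R) (M : R) :
    (forall c x, f (c *: x) = c * f x) ->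
    (forall x, f x *+ 2 - s x x <= M) ->
  0 <= M /\ forall x, `|f x| <= Num.sqrt M * seminorm x.
Proof.
move=> fZ fM.
have M0 : 0 <= M.
  apply: le_trans (fM 0); rewrite semi_form0l subr0.
  by rewrite -[X in f X](scale0r 0) fZ mul0r mul0rn.
split=> // x.
(* Rescaling [x] frees a parameter [t] to be optimized. *)
have fx t : t * f x *+ 2 - t ^+ 2 * s x x <= M.
  by have := fM (t *: x); rewrite fZ semi_formZl semi_formZr mulrA -expr2.
rewrite -ler_sqr ?nnegrE ?mulr_ge0 ?sqrtr_ge0 ?normr_ge0//.
rewrite exprMn real_normK ?num_real// seminorm_sqr sqr_sqrtr//.
have := semi_form_ge0 s x; rewrite le_eqVlt => /predU1P[s0|s_gt0].
  suff -> : f x = 0 by rewrite expr0n -s0 mulr0.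
  apply/eqP; apply: contraT => fx0.
  (* This [t] turns the bound into [2 (M + 1) <= M], against [0 <= M]. *)
  have := fx ((M + 1) / f x); rewrite -s0 mulr0 subr0 divfK//; lra.
(* This [t] maximizes the left-hand side. *)
have := fx (f x / s x x).
have -> : f x / s x x * f x *+ 2 - (f x / s x x) ^+ 2 * s x x
          = f x ^+ 2 / s x x by field; rewrite gt_eqF.
by rewrite ler_pdivrMr.
Qed.

(** Expanding [0 <= s (y - a) (y - a)] gives the hypothesis of [functional_bound_sqr] for [s^~ a]
    with [M = s a a]. *)
Lemma semi_cauchy_schwarz x a : `|s x a| <= seminorm a * seminorm x.
Proof.
have [c y|y|_ //] := @functional_bound_sqr (s^~ a) (s a a).
  exact: semi_formZl.
have := semi_form_ge0 s (y - a).
rewrite semi_formDl !semi_formDr !semi_formNl !semi_formNr (semi_formC s a y).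
lra.
Qed.

Lemma seminormD x y : seminorm (x + y) <= seminorm x + seminorm y.
Proof.
rewrite -ler_sqr ?nnegrE ?addr_ge0 ?seminorm_ge0// sqrrD !seminorm_sqr.
rewrite semi_formDl !semi_formDr (semi_formC s y x).
have := le_trans (ler_norm _) (semi_cauchy_schwarz x y); lra.
Qed.

End SemiInnerTheory.

(** * The Banach space of bounded functionals *)

Section Dual.
Variables (R : realType) (E : lmodType R) (s : semi_inner E).

(** A predicate on all functions, so that [dual] inherits its module structure as a submodule. *)
Definition bounded_functional : {pred (E -> R^o)} :=
  fun f => `[< (forall c x y, f (c *: x + y) = c * f x + f y) /\
               exists C, forall x, `|f x| <= C * seminorm s x >].

Lemma bounded_functional_submod : subsemimod_closed bounded_functional.
Proof.
split; [split|].
- apply/asboolP; split=> [c x y|].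
    by rewrite -[RHS]/(c * 0 + 0 : R) mulr0 addr0.
  by exists 0 => x; rewrite -[X in `|X|]/(0 : R) normr0 mul0r.
- move=> f g /asboolP[fL [C fC]] /asboolP[gL [D gD]]; apply/asboolP.
  split=> [c x y|]; first by rewrite !fctE fL gL; ring.
  exists (C + D) => x; rewrite mulrDl (le_trans (ler_normD _ _))//.
  exact: lerD.
- move=> a f /asboolP[fL [C fC]]; apply/asboolP.
  split=> [c x y|]; first by rewrite !fctE fL /GRing.scale/=; ring.
  exists (`|a| * C) => x.
  by rewrite /GRing.scale/= normrM -mulrA ler_wpM2l.
Qed.

HB.instance Definition _ := GRing.isSubmodClosed.Build R (E -> R^o)
  bounded_functional bounded_functional_submod.

Record dual := Dual {
  dual_fun :> E -> R^o;
  dualP : dual_fun \in bounded_functional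
}.

HB.instance Definition _ := [isSub for dual_fun].
HB.instance Definition _ := [Choice of dual by <:].
HB.instance Definition _ := [SubChoice_isSubLmodule of dual by <:].

Implicit Types f g : dual.

Lemma dual_linear f c x y : f (c *: x + y) = c * f x + f y.
Proof. by have /asboolP[+ _] := dualP f; apply. Qed.

Lemma dual_ext f g : f =1 g -> f = g.
Proof. by move=> fg; apply/val_inj/funext. Qed.

Lemma dual_funP c f g x : (c *: f + g) x = c * f x + g x.
Proof. by []. Qed.

Lemma dual0 f : f 0 = 0.
Proof.
by have := dual_linear f (-1) 0 0; rewrite scaler0 addr0 mulN1r addNr.
Qed.

Lemma dualD f x y : f (x + y) = f x + f y.
Proof. by have := dual_linear f 1 x y; rewrite scale1r mul1r. Qed.

Lemma dualZ f c x : f (c *: x) = c * f x.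
Proof. by have := dual_linear f c x 0; rewrite dual0 !addr0. Qed.

Lemma dualN f x : f (- x) = - f x.
Proof. by rewrite -scaleN1r dualZ mulN1r. Qed.

Lemma dual_sumr f d (e : 'I_d -> E) : f (\sum_i e i) = \sum_i f (e i).
Proof. by elim/big_rec2: _ => [|i r x _ <-]; rewrite ?dual0 ?dualD. Qed.

Lemma dual_suml d (f : 'I_d -> dual) x : (\sum_i f i) x = \sum_i f i x.
Proof. by elim/big_rec2: _ => [//|i r g _ <-]. Qed.

Definition dual_norm f : R :=
  best_constant (fun x => `|f x|) (seminorm s).

Lemma dual_bounded f :
  exists C, bounded_by (fun x => `|f x|) (seminorm s) C.
Proof.
have /asboolP[_ [C fC]] := dualP f; exists `|C|; split=> // x.
apply: le_trans (fC x) _; rewrite ler_wpM2r ?seminorm_ge0//.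
exact: ler_norm.
Qed.

Lemma dual_normP f x : `|f x| <= dual_norm f * seminorm s x.
Proof. by apply: best_constantP (dual_bounded f) _; exact: seminorm_ge0. Qed.

Lemma dual_norm_ge0 f : 0 <= dual_norm f.
Proof. exact: best_constant_ge0 (dual_bounded f). Qed.

Lemma dual_norm_le f C : 0 <= C ->
  (forall x, `|f x| <= C * seminorm s x) -> dual_norm f <= C.
Proof. by move=> C0 fC; apply: best_constant_le. Qed.

Lemma dual_normD f g : dual_norm (f + g) <= dual_norm f + dual_norm g.
Proof.
apply: dual_norm_le => [|x]; first by rewrite addr_ge0 ?dual_norm_ge0.
rewrite mulrDl (le_trans (ler_normD (f x) (g x)))//.
by rewrite lerD ?dual_normP.
Qed.

Lemma dual_normZ_le c f : dual_norm (c *: f) <= `|c| * dual_norm f.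
Proof.
apply: dual_norm_le => [|x]; first by rewrite mulr_ge0 ?dual_norm_ge0.
rewrite -[(c *: f) x]/(c * f x) normrM -mulrA ler_wpM2l//.
exact: dual_normP.
Qed.

(** The reverse inequality is the direct one applied to [c^-1] and [c *: f]. *)
Lemma dual_normZ c f : dual_norm (c *: f) = `|c| * dual_norm f.
Proof.
apply/eqP; rewrite eq_le dual_normZ_le/=.
have [->|c0] := eqVneq c 0; first by rewrite normr0 mul0r dual_norm_ge0.
have := dual_normZ_le c^-1 (c *: f).
by rewrite scalerA mulVf// scale1r normfV ler_pdivlMl ?normr_gt0.
Qed.

Lemma dual_norm_eq0 f : dual_norm f = 0 -> f = 0.
Proof.
move=> f0; apply: dual_ext => x; apply/eqP; rewrite -normr_le0.
by rewrite (le_trans (dual_normP f x))// f0 mul0r.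
Qed.

HB.instance Definition _ := Lmodule_isNormed.Build R dual
  dual_normD dual_normZ dual_norm_eq0.

Lemma dual_normE f : `|f| = dual_norm f. Proof. by []. Qed.

(** Evaluation at a point is Lipschitz for the norm, so a Cauchy filter has a pointwise limit [h];
    norm estimates hold pointwise with uniform constants and survive in the limit. *)
Lemma dual_complete (F : set_system dual) :
  ProperFilter F -> cauchy F -> cvg F.
Proof.
move=> FF /cauchyP F_cauchy.
have close (e : R) : 0 < e -> exists g, F [set f : dual | `|g - f| < e].
  by move=> /F_cauchy[g Fg]; exists g.
have eval_le f g x : `|f x - g x| <= `|f - g| * seminorm s x.
  exact: dual_normP (f - g) x.
have ev_cauchy x : cvg ((fun f : dual => f x) @ F).
  apply/cauchy_cvgP/cauchyP => e e0.
  (* Adding 1 keeps the divisor positive where the seminorm vanishes. *)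
  have q1 : 0 < seminorm s x + 1 by rewrite ltr_wpDl ?seminorm_ge0.
  have [g Fg] := close (e / (seminorm s x + 1)) (divr_gt0 e0 q1).
  exists (g x); change (F [set f : dual | `|g x - f x| < e]).
  apply: filterS Fg => f /=; rewrite ltr_pdivlMr//; apply: le_lt_trans.
  by rewrite (le_trans (eval_le _ _ _))// ler_wpM2l// lerDl.
pose h : E -> R^o := fun x => lim ((fun f : dual => f x) @ F).
have hP x : (fun f : dual => f x) @ F --> h x by exact: ev_cauchy.
have h_close e g x : F [set f : dual | `|g - f| < e] ->
    `|g x - h x| <= e * seminorm s x.
  move=> Fg; have gh : (fun f : dual => `|g x - f x|) @ F --> `|g x - h x|.
    by apply: cvg_norm; apply: cvgB; [exact: cvg_cst|exact: hP].
  apply: (cvgr_to_le gh); apply: filterS Fg => f /= /ltW gfe.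
  by apply: le_trans (eval_le _ _ _) _; rewrite ler_wpM2r ?seminorm_ge0.
have hlin c x y : h (c *: x + y) = c * h x + h y.
  have : (fun f : dual => f (c *: x + y)) @ F --> c * h x + h y.
    under eq_fun do rewrite dual_linear.
    by apply: cvgD => //; apply: cvgM => //; exact: cvg_cst.
  by move/cvg_lim => <-.
have hB : h \in bounded_functional.
  apply/asboolP; split=> //; have [g Fg] := close 1 ltr01.
  exists (1 + `|g|) => x; rewrite mulrDl -(subrK (g x) (h x)).
  rewrite (le_trans (ler_normD _ _))// lerD//; last exact: dual_normP.
  by rewrite distrC h_close.
apply/cvg_ex; exists (Dual hB); apply/cvgrPdist_le => e e0.
have [g Fg] := close (e / 2) (divr_gt0 e0 (ltr0Sn _ 1)).
have gh : `|Dual hB - g| <= e / 2.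
  apply: dual_norm_le => [|x]; first by rewrite divr_ge0 ?ltW.
  by rewrite -[X in `|X|]/(h x - g x) distrC h_close.
apply: filterS Fg => f /= /ltW gf.
by rewrite (le_trans (ler_distD g _ _))// [e]splitr lerD.
Qed.

HB.instance Definition _ := Uniform_isComplete.Build dual dual_complete.

(** From [(|f| - |x|)^2 >= 0]. Together with [dual_norm_sqr_le] this identifies [|f|^2] with the
    supremum of [2 f x - s x x], the only description of the norm that the Hilbert structure relies
    on. *)
Lemma dual_norm_sqr_ge f x : f x *+ 2 - s x x <= `|f| ^+ 2.
Proof.
rewrite -seminorm_sqr; have := dual_normP f x; rewrite -dual_normE.
have := ler_norm (f x); have := sqr_ge0 (`|f| - seminorm s x); nra.
Qed.

Lemma dual_norm_sqr_le f M :
  (forall x, f x *+ 2 - s x x <= M) -> `|f| ^+ 2 <= M.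
Proof.
move=> /(functional_bound_sqr (dualZ f))[M0 fM].
rewrite -[leRHS]sqr_sqrtr// ler_sqr ?nnegrE ?sqrtr_ge0 ?normr_ge0//.
by apply: dual_norm_le => //; exact: sqrtr_ge0.
Qed.

Lemma semi_form_bounded a : s^~ a \in bounded_functional.
Proof.
apply/asboolP; split=> [c x y|]; first exact: semi_formP.
exists (seminorm s a) => x; exact: semi_cauchy_schwarz.
Qed.

Definition riesz a : dual := Dual (semi_form_bounded a).

Lemma riesz_linear : linear riesz.
Proof.
move=> c x y; apply: dual_ext => z /=.
by rewrite semi_formDr semi_formZr.
Qed.

HB.instance Definition _ := GRing.isLinear.Build R E dual _ riesz riesz_linear.

(** Substituting [x - b] for [x] in the supremum formula completes the square and gives one
    inequality; the other is the same inequality for [f + riesz a] and [- a]. *)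
Lemma norm_dual_addriesz f a :
  `|f + riesz a| ^+ 2 = `|f| ^+ 2 + f a *+ 2 + s a a.
Proof.
have le_add g b : `|g + riesz b| ^+ 2 <= `|g| ^+ 2 + g b *+ 2 + s b b.
  apply: dual_norm_sqr_le => x.
  have := dual_norm_sqr_ge g (x - b).
  rewrite -[(g + _) x]/(g x + s x b) dualD dualN.
  rewrite semi_formDl !semi_formDr !semi_formNl !semi_formNr (semi_formC s b x).
  lra.
apply/eqP; rewrite eq_le le_add/=.
have := le_add (f + riesz a) (- a); rewrite linearN addrK.
rewrite -[(f + _) _]/(f (- a) + s (- a) a) dualN.
rewrite !semi_formNl !semi_formNr; lra.
Qed.

Lemma norm_riesz a : `|riesz a| ^+ 2 = s a a.
Proof.
have := norm_dual_addriesz 0 a.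
by rewrite add0r normr0 expr0n mul0rn !add0r.
Qed.

(** If every [riesz a] were at distance at least [e] from [f], then [2 f a - s a a <= |f|^2 - e^2]
    for all [a], so the supremum [|f|^2] would be smaller than itself. *)
Lemma riesz_dense f (e : R) : 0 < e -> exists a, `|f - riesz a| < e.
Proof.
move=> e0; apply: contrapT => no_a.
suff : `|f| ^+ 2 <= `|f| ^+ 2 - e ^+ 2.
  by rewrite lerDl oppr_ge0 leNgt exprn_gt0.
apply: dual_norm_sqr_le => a; rewrite leNgt; apply/negP => fa; apply: no_a.
exists a; rewrite -ltr_sqr ?nnegrE ?(ltW e0)// -linearN norm_dual_addriesz.
rewrite dualN semi_formNl semi_formNr; lra.
Qed.

End Dual.

(** * The Hilbert space structure of the dual *)

Section DualHilbert.
Variables (R : realType) (E : lmodType R) (s : semi_inner E).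
Implicit Types f g h : dual s.

(** The polarization formula makes symmetry and continuity immediate; bilinearity has to come from
    the density of [riesz]. *)
Definition dual_inner f g : R := (`|f + g| ^+ 2 - `|f| ^+ 2 - `|g| ^+ 2) / 2.

Lemma dual_inner_riesz f a : dual_inner f (riesz s a) = f a.
Proof. rewrite /dual_inner norm_dual_addriesz norm_riesz; lra. Qed.

Lemma dual_innerC f g : dual_inner f g = dual_inner g f.
Proof. by rewrite /dual_inner (addrC f); ring. Qed.

Lemma dual_inner_norm f : dual_inner f f = `|f| ^+ 2.
Proof.
rewrite /dual_inner -mulr2n -scaler_nat normrZ ger0_norm ?ler0n//; lra.
Qed.

Lemma riesz_cvg g : exists a : nat -> E, riesz s (a n) @[n --> \oo] --> g.
Proof.
have /choice[a ga] (n : nat) : exists a, `|g - riesz s a| < n.+1%:R^-1.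
  by apply: riesz_dense; rewrite invr_gt0 ltr0n.
exists a; apply/cvgrPdist_lt => e e0.
near=> n; apply: lt_trans (ga n) _; near: n.
exact: (near_infty_natSinv_lt (PosNum e0)).
Unshelve. all: by end_near. Qed.

Lemma dual_inner_cvg f g (u : nat -> dual s) :
  u n @[n --> \oo] --> g -> dual_inner f (u n) @[n --> \oo] --> dual_inner f g.
Proof.
have sqr_cvg (v : nat -> dual s) (l : dual s) :
    v n @[n --> \oo] --> l -> `|v n| ^+ 2 @[n --> \oo] --> `|l| ^+ 2.
  by move=> vl; exact: cvgM (cvg_norm vl) (cvg_norm vl).
move=> ug; rewrite /dual_inner; apply: cvgMl; apply: cvgB; last exact: sqr_cvg.
apply: cvgB; last exact: cvg_cst.
by apply: (sqr_cvg (fun n => f + u n)); apply: cvgD => //; exact: cvg_cst.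
Qed.

Lemma dual_inner_lim f g (a : nat -> E) :
  riesz s (a n) @[n --> \oo] --> g -> f (a n) @[n --> \oo] --> dual_inner f g.
Proof.
by move=> /(dual_inner_cvg (f := f)); under eq_fun do rewrite dual_inner_riesz.
Qed.

(** Against [riesz a] the form is evaluation at [a], which is linear in the functional; a general
    [g] is a limit of such vectors. *)
Lemma dual_inner_linearl g : GRing.linear_for *%R (dual_inner ^~ g).
Proof.
move=> c f1 f2; have [a ag] := riesz_cvg g.
have := dual_inner_lim (f := c *: f1 + f2) ag => /cvg_lim <- //.
apply/cvg_lim => //.
apply: cvgD; last exact: dual_inner_lim.
by apply: cvgMr; exact: dual_inner_lim.
Qed.

Lemma dual_inner_bilinear :
  bilinear_for *%R (idfun \; *%R) (dual_inner : dual s -> dual s -> R).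
Proof.
split=> [g|f]; first exact: dual_inner_linearl.
by move=> c g1 g2 /=; rewrite !(dual_innerC f) dual_inner_linearl.
Qed.

HB.instance Definition _ := bilinear_isBilinear.Build R (dual s) (dual s) R
  *%R (idfun \; *%R) dual_inner dual_inner_bilinear.

Lemma dual_inner_hermitian f g :
  dual_inner f g = (-1) ^+ false * idfun (dual_inner g f).
Proof. by rewrite expr0 mul1r dual_innerC. Qed.

HB.instance Definition _ := isHermitianSesquilinear.Build R (dual s) false idfun
  dual_inner dual_inner_hermitian.

Lemma dual_inner_gt0 f : f != 0 -> 0 < dual_inner f f.
Proof. by move=> f0; rewrite dual_inner_norm exprn_gt0// normr_gt0. Qed.

HB.instance Definition _ := isDotProduct.Build R (dual s)
  dual_inner dual_inner_gt0.

Definition dual_hilbert : realHilbert R :=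
  @RealHilbert R (dual s) dual_inner dual_inner_norm.

End DualHilbert.

(** * Bounded operators on a real Hilbert space *)

Section HilbertTheory.
Variables (R : realType) (H : realHilbert R).
Implicit Types x y z : H.

Definition hilbert_form x y : R := inner H x y.

Lemma hilbert_formC x y : hilbert_form x y = hilbert_form y x.
Proof. by rewrite /hilbert_form hermC expr0 mul1r. Qed.

Lemma hilbert_formP c x y z :
  hilbert_form (c *: x + y) z = c * hilbert_form x z + hilbert_form y z.
Proof. by rewrite /hilbert_form linearPl. Qed.

Lemma hilbert_form_ge0 x : 0 <= hilbert_form x x.
Proof. by rewrite /hilbert_form inner_norm exprn_ge0. Qed.

(** Makes the theory of semi-inner products and their duals available for [H] itself. *)
Definition hilbert_semi : semi_inner H :=
  SemiInner hilbert_formC hilbert_formP hilbert_form_ge0.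

Local Notation "''[' x , y ]" := (hilbert_semi x y).

Lemma hilbert_normE x : seminorm hilbert_semi x = `|x|.
Proof.
by rewrite /seminorm [hilbert_semi _ _]inner_norm sqrtr_sqr normr_id.
Qed.

Lemma cauchy_schwarz x y : `|'[x, y]| <= `|x| * `|y|.
Proof. by rewrite mulrC -!hilbert_normE; exact: semi_cauchy_schwarz. Qed.

Lemma inner_ext x y : (forall z, '[x, z] = '[y, z]) -> x = y.
Proof.
move=> xy; apply/subr0_eq/eqP; rewrite -normr_eq0 -sqrf_eq0 -inner_norm.
by rewrite -[inner H _ _]/'[_, _] semi_formDl semi_formNl xy subrr.
Qed.

(** By density [f] is a limit of vectors [riesz (a n)]. As [riesz] is isometric, [a] is Cauchy, and
    its limit in the complete space [H] represents [f]. *)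
Lemma riesz_representation (f : dual hilbert_semi) :
  exists y, forall x, f x = '[x, y].
Proof.
have [a af] := riesz_cvg f.
have riesz_isometry x : `|riesz hilbert_semi x| = `|x|.
  by apply/eqP; rewrite -(@eqrXn2 _ 2)// norm_riesz -hilbert_normE seminorm_sqr.
have a_cvg : cvg (a n @[n --> \oo]).
  apply/cauchy_cvgP/cauchyP => e e0.
  have : \forall n \near \oo, `|f - riesz hilbert_semi (a n)| < e / 2.
    by move/cvgrPdist_lt: af; apply; rewrite divr_gt0.
  case=> N _ aN; exists (a N); exists N => // n /= Nn.
  rewrite -ball_normE /= -riesz_isometry linearB/=.
  rewrite (le_lt_trans (ler_distD f _ _))// [e]splitr ltrD//.
    by rewrite distrC; apply: aN => /=.
  exact: aN.
set y := lim (a n @[n --> \oo]) in a_cvg; exists y => x.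
suff -> : f = riesz hilbert_semi y by [].
suff : riesz hilbert_semi (a n) @[n --> \oo] --> riesz hilbert_semi y.
  by move=> /cvg_lim <- //; apply/esym/cvg_lim.
apply/cvgrPdist_lt => e e0.
have /cvgrPdist_lt/(_ e e0) := a_cvg.
by apply: filterS => n; rewrite -linearB riesz_isometry.
Qed.

End HilbertTheory.

Local Notation "''[' x , y ]" := (hilbert_semi _ x y).

(** * The real C*-algebra of all bounded operators *)

Section OperatorAlgebra.
Variables (R : realType) (H : realHilbert R).
Implicit Types x y z : H.

(** The adjoint relation implies that both maps are linear and carries the bound over to the second
    one. *)
Definition adjoint_pair : {pred (H -> H) * (H -> H)} :=
  fun p => `[< (forall x y, '[p.1 x, y] = '[x, p.2 y]) /\
      exists C, bounded_by (fun x => `|p.1 x|) (fun x : H => `|x|) C >].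

Lemma adjoint_pair_submod : subsemimod_closed adjoint_pair.
Proof.
split; [split|].
- apply/asboolP; split=> [x y|].
    by rewrite [LHS]semi_form0l [RHS]semi_formC semi_form0l.
  by exists 0; split=> // x; rewrite normr0 mul0r.
- move=> [S S'] [T T'] /asboolP[/= adjS [C [C0 SC]]].
  move=> /asboolP[/= adjT [D [D0 TD]]]; apply/asboolP; split=> [x y|].
    rewrite [LHS]semi_formDl [RHS]semi_formDr.
    by congr (_ + _); [exact: adjS|exact: adjT].
  exists (C + D); split=> [|x]; first exact: addr_ge0.
  by rewrite mulrDl (le_trans (ler_normD _ _))// lerD.
- move=> c [S S'] /asboolP[/= adjS [C [C0 SC]]]; apply/asboolP.
  split=> [x y|].
    by rewrite [LHS]semi_formZl [RHS]semi_formZr; congr (_ * _); exact: adjS.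
  exists (`|c| * C); split=> [|x]; first exact: mulr_ge0.
  by rewrite normrZ -mulrA ler_wpM2l.
Qed.

HB.instance Definition _ := GRing.isSubmodClosed.Build R
  ((H -> H) * (H -> H))%type adjoint_pair adjoint_pair_submod.

(* Carrying the adjoint along makes the involution a swap. The nonzero vector
   [u] only serves to make the ring nontrivial. *)
Record operator (u : {x : H | x != 0}) := Operator {
  operator_pair : (H -> H) * (H -> H);
  operatorP : operator_pair \in adjoint_pair
}.

Variable u : {x : H | x != 0}.
Local Notation op := (operator u).

HB.instance Definition _ := [isSub for @operator_pair u].
HB.instance Definition _ := [Choice of op by <:].
HB.instance Definition _ := [SubChoice_isSubLmodule of op by <:].

Definition op_fun (T : op) : H -> H := (operator_pair T).1.
Definition op_adj (T : op) : H -> H := (operator_pair T).2.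

Implicit Types S T : op.

Lemma op_adjP T x y : '[op_fun T x, y] = '[x, op_adj T y].
Proof. by have /asboolP[+ _] := operatorP T; apply. Qed.

Lemma op_fun_bounded T :
  exists C, bounded_by (fun x => `|op_fun T x|) (fun x : H => `|x|) C.
Proof. by have /asboolP[] := operatorP T. Qed.

(** The inner product is nondegenerate, so the first map determines its adjoint; the algebra laws
    are then checked on first maps only. *)
Lemma op_ext S T : op_fun S =1 op_fun T -> S = T.
Proof.
move=> ST; apply: val_inj.
rewrite [LHS]surjective_pairing [RHS]surjective_pairing.
congr pair; apply/funext => x; first exact: ST.
apply: inner_ext => z; rewrite ![hilbert_semi _ _ z]semi_formC.
by rewrite -!op_adjP ST.
Qed.

Lemma op_funP c S T x :
  op_fun (c *: S + T) x = c *: op_fun S x + op_fun T x.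
Proof. by []. Qed.

Lemma op_fun_sum d (T : 'I_d -> op) x :
  op_fun (\sum_i T i) x = \sum_i op_fun (T i) x.
Proof. by elim/big_rec2: _ => [//|i r S _ <-]. Qed.

Lemma op_fun_linear T : linear (op_fun T).
Proof.
move=> c x y; apply: inner_ext => z.
by rewrite op_adjP !semi_formDl !semi_formZl !op_adjP.
Qed.

HB.instance Definition _ T :=
  GRing.isLinear.Build R H H _ (op_fun T) (op_fun_linear T).

Definition op_lin T : {linear H -> H} := op_fun T.

(** Writing [T'] for the adjoint, [|T' x|^2 = '[T (T' x), x] <= C |T' x| |x|], and one factor
    [|T' x|] cancels. *)
Lemma adjoint_pair_swap T :
  ((operator_pair T).2, (operator_pair T).1) \in adjoint_pair.
Proof.
apply/asboolP; split=> [x y|/=].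
  by rewrite semi_formC -op_adjP semi_formC.
have [C [C0 TC]] := op_fun_bounded T; exists C; split=> // x.
rewrite -[X in `|X|]/(op_adj T x).
have [->|] := eqVneq (op_adj T x) 0; first by rewrite normr0 mulr_ge0.
rewrite -normr_gt0 => /ler_pM2l <-; rewrite -expr2 -inner_norm.
rewrite -[inner H _ _]/'[_, _] -op_adjP.
rewrite (le_trans (ler_norm _))// (le_trans (cauchy_schwarz _ _))//.
by rewrite mulrA ler_wpM2r// mulrC.
Qed.

Lemma adjoint_pair_id : (id : H -> H, id : H -> H) \in adjoint_pair.
Proof.
by apply/asboolP; split=> //; exists 1; split=> // x; rewrite mul1r.
Qed.

Lemma adjoint_pair_comp S T :
  (op_fun S \o op_fun T, op_adj T \o op_adj S) \in adjoint_pair.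
Proof.
apply/asboolP; split=> [x y|/=].
  exact: etrans (op_adjP _ _ _) (op_adjP _ _ _).
have [C [C0 SC]] := op_fun_bounded S; have [D [D0 TD]] := op_fun_bounded T.
exists (C * D); split=> [|x]; first exact: mulr_ge0.
by rewrite (le_trans (SC _))// -mulrA ler_wpM2l.
Qed.

Definition adjoint_op T : op := Operator u (adjoint_pair_swap T).
Definition id_op : op := Operator u adjoint_pair_id.
Definition comp_op S T : op := Operator u (adjoint_pair_comp S T).

Lemma comp_opA : associative comp_op.
Proof. by move=> S T U; exact: op_ext. Qed.

Lemma comp_op1l : left_id id_op comp_op.
Proof. by move=> T; exact: op_ext. Qed.

Lemma comp_op1r : right_id id_op comp_op.
Proof. by move=> T; exact: op_ext. Qed.

Lemma comp_opDl : left_distributive comp_op +%R.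
Proof. by move=> S T U; exact: op_ext. Qed.

Lemma comp_opDr : right_distributive comp_op +%R.
Proof.
by move=> S T U; apply: op_ext => x; exact: (linearD (op_lin S)).
Qed.

Lemma id_op_neq0 : id_op != 0.
Proof.
apply/eqP => /(congr1 (fun T => op_fun T (sval u))) /= u0.
by have := svalP u; rewrite -[sval u]/(op_fun id_op (sval u)) u0 eqxx.
Qed.

HB.instance Definition _ := GRing.Zmodule_isNzRing.Build op
  comp_opA comp_op1l comp_op1r comp_opDl comp_opDr id_op_neq0.

Lemma op_scalerAl (c : R) S T : c *: (S * T) = (c *: S) * T.
Proof. exact: op_ext. Qed.

HB.instance Definition _ := GRing.Lmodule_isLalgebra.Build R op op_scalerAl.

Lemma op_scalerAr (c : R) S T : c *: (S * T) = S * (c *: T).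
Proof.
by apply: op_ext => x; exact: esym (linearZZ (op_lin S) c (op_fun T x)).
Qed.

HB.instance Definition _ := GRing.Lalgebra_isAlgebra.Build R op op_scalerAr.

Lemma adjoint_opK : involutive adjoint_op.
Proof. by move=> T; exact: op_ext. Qed.

Lemma adjoint_opD : {morph adjoint_op : S T / S + T}.
Proof. by move=> S T; exact: op_ext. Qed.

Lemma adjoint_opZ (c : R) T : adjoint_op (c *: T) = idfun c *: adjoint_op T.
Proof. exact: op_ext. Qed.

Lemma adjoint_opM S T : adjoint_op (S * T) = adjoint_op T * adjoint_op S.
Proof. exact: op_ext. Qed.

HB.instance Definition _ := Algebra_isStar.Build R idfun op
  adjoint_opK adjoint_opD adjoint_opZ adjoint_opM.

(** Representing the functionals ['[T x, y]] in [x] provides an adjoint for every bounded linear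
    [T]. So [op] consists of all bounded operators and is norm closed. *)
Lemma operator_real_cstar : is_real_cstar op.
Proof.
have bdd_cont (T : {linear H -> H}) : continuous T <->
    exists C, bounded_by (fun x => `|T x|) (fun x : H => `|x|) C.
  split=> [/(_ 0)/continuous_linear_bounded|[C [C0 TC]]].
    move=> /(_ 0)/linear_boundedP/pinfty_ex_gt0[C C0 TC].
    by exists C; split=> //; exact: ltW.
  apply: bounded_linear_continuous; apply/linear_boundedP.
  near=> r => x; rewrite (le_trans (TC x))// ler_wpM2r//.
exists H, op_lin; split.
- by move=> T; apply/bdd_cont; exact: op_fun_bounded.
- by [].
- by [].
- move=> T x y; exact: op_adjP.
- by move=> S T; exact: op_ext.
move=> T /bdd_cont[C TC] _.
have funB y : (fun x => '[T x, y]) \in bounded_functional (hilbert_semi H).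
  apply/asboolP; split=> [c x z|].
    by rewrite linearP semi_formDl semi_formZl.
  exists (C * `|y|) => x; rewrite hilbert_normE.
  rewrite (le_trans (cauchy_schwarz _ _))// mulrAC ler_wpM2r//; exact: TC.2.
have /choice[T' adjT] y : exists z, forall x, '[T x, y] = '[x, z].
  by have [z Tz] := riesz_representation (Dual (funB y)); exists z.
have TT' : (T : H -> H, T') \in adjoint_pair.
  by apply/asboolP; split=> [x y|]; [exact: adjT|exists C].
by exists (Operator u TT').
Unshelve. all: by end_near. Qed.

End OperatorAlgebra.

(** * From complex to real *)

(** Take a longest family whose images are linearly independent; its length is at most [N]. By
    maximality the images span the image of [g], and injectivity pulls the relations back to [V]. *)
Lemma finite_dimensional_inj (K : numFieldType) (V : lmodType K) (N : nat)
    (g : {linear V -> 'rV[K]_N}) : injective g -> finite_dimensional V.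
Proof.
move=> g_inj.
pose rk (r : nat) := `[< exists v : 'I_r -> V, row_free (\matrix_i g (v i)) >].
have rk0 : exists r, rk r.
  exists 0%N; apply/asboolP; exists (fun=> 0).
  by rewrite /row_free -leqn0 rank_leq_row.
have rkN r : rk r -> (r <= N)%N.
  by move=> /asboolP[v /eqP <-]; exact: rank_leq_col.
have [r /asboolP[v v_free] r_max] := ex_maxnP rk0 rkN.
exists r, v => x.
suff /submxP[c xE] : (g x <= \matrix_i g (v i))%MS.
  exists (fun i => c 0 i); apply: g_inj; rewrite xE linear_sum mulmx_sum_row.
  by apply: eq_bigr => i _; rewrite linearZ rowK.
apply: contraT => gx.
suff /r_max : rk r.+1 by rewrite ltnn.
(* A vector [x] with [g x] outside the row space could be prepended to the family. *)
apply/asboolP; exists (fun i : 'I_(1 + r) =>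
  if fintype.split i is inr j then v j else x).
have -> : \matrix_i g (if fintype.split i is inr j then v j else x)
          = col_mx (g x) (\matrix_i g (v i)).
  apply/row_matrixP => i; rewrite rowK; case: splitP => j ij.
    have -> : i = lshift r j by exact: val_inj.
    by rewrite rowKu row_id.
  have -> : i = rshift 1 j by exact: val_inj.
  by rewrite rowKd rowK.
rewrite -row_leq_rank.
suff : (\rank (\matrix_i g (v i)) < \rank (col_mx (g x) (\matrix_i g (v i))))%N.
  by rewrite (eqP v_free).
apply: rank_ltmx.
rewrite ltmxE col_mx_sub negb_and gx andbT.
by rewrite -addsmxE addsmxSr.
Qed.

(** * Lifting projections to the Hilbert completion *)

Section SymmetricIdempotent.
Variables (R : realType) (E : lmodType R) (s : semi_inner E).

Record symmetric_idempotent (S : E -> E) : Prop := {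
  sym_idem_linear : linear S;
  sym_idem_sym : forall x y, s (S x) y = s x (S y);
  sym_idemK : forall x, S (S x) = S x
}.

Variables (S : E -> E) (hS : symmetric_idempotent S).

(** Pythagoras: [s (x - S x) (x - S x) = s x x - s (S x) (S x)]. *)
Lemma sym_idem_le x : seminorm s (S x) <= seminorm s x.
Proof.
apply: ler_wsqrtr; have := semi_form_ge0 s (x - S x).
rewrite semi_formDl !semi_formDr !semi_formNl !semi_formNr.
rewrite !(sym_idem_sym hS) (sym_idemK hS); lra.
Qed.

Lemma dual_comp_subproof (f : dual s) : f \o S \in bounded_functional s.
Proof.
apply/asboolP; split=> [c x y /=|].
  by rewrite (sym_idem_linear hS) dual_linear.
exists `|f| => x /=; rewrite (le_trans (dual_normP f (S x)))// dual_normE.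
by rewrite ler_wpM2l ?dual_norm_ge0// sym_idem_le.
Qed.

(** The transpose of [S]; by symmetry of [S] it is also the extension of [S] along [riesz]. *)
Definition dual_comp (f : dual s) : dual s := Dual (dual_comp_subproof f).

Lemma dual_comp_riesz x : dual_comp (riesz s x) = riesz s (S x).
Proof. by apply: dual_ext => y /=; rewrite (sym_idem_sym hS). Qed.

Lemma dual_comp_le f : `|dual_comp f| <= `|f|.
Proof.
apply: dual_norm_le => [|x]; first exact: normr_ge0.
rewrite (le_trans (dual_normP f (S x)))// dual_normE.
by rewrite ler_wpM2l ?dual_norm_ge0// sym_idem_le.
Qed.

Lemma dual_compB f g : dual_comp (f - g) = dual_comp f - dual_comp g.
Proof. exact: dual_ext. Qed.

(** Both sides are continuous in [g] and equal [f (S a)] at [g = riesz a]. *)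
Lemma dual_comp_sym f g :
  dual_inner (dual_comp f) g = dual_inner f (dual_comp g).
Proof.
have [a ag] := riesz_cvg g.
have lim_l := dual_inner_lim (f := dual_comp f) ag.
have lim_r : riesz s (S (a n)) @[n --> \oo] --> dual_comp g.
  apply/cvgrPdist_lt => e e0; have /cvgrPdist_lt/(_ e e0) := ag.
  apply: filterS => n; rewrite -dual_comp_riesz -dual_compB.
  exact/le_lt_trans/dual_comp_le.
have lim_r' := dual_inner_lim (f := f) lim_r.
by rewrite -(cvg_lim _ lim_l)// -(cvg_lim _ lim_r').
Qed.

Variable u : {f : dual_hilbert s | f != 0}.

Lemma dual_comp_adjoint_pair :
  (dual_comp : dual_hilbert s -> dual_hilbert s,
   dual_comp : dual_hilbert s -> dual_hilbert s)
  \in @adjoint_pair R (dual_hilbert s).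
Proof.
apply/asboolP; split=> [f g|/=]; first exact: dual_comp_sym.
by exists 1; split=> // f; rewrite mul1r; exact: dual_comp_le.
Qed.

Definition lift_op : operator u := Operator u dual_comp_adjoint_pair.

Lemma lift_op_projection : is_projection lift_op.
Proof.
split; first exact: op_ext.
apply: op_ext => f; apply: dual_ext => x.
by rewrite /= /dual_comp /= (sym_idemK hS).
Qed.

End SymmetricIdempotent.

Local Open Scope complex_scope.

(** The values of [T (riesz (e i))] at [e j] determine [T]: they fix [T] on the image of [riesz],
    hence the adjoint there, and [T f] at [y] is the inner product of [f] with the adjoint at
    [riesz y]. *)
Lemma operator_finite_dimensional (R : realType) (E : lmodType R)
    (s : semi_inner E) (u : {f : dual_hilbert s | f != 0}) :
  finite_dimensional E -> finite_dimensional (operator u).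
Proof.
move=> [d [e e_span]].
pose g (T : operator u) : 'rV[R]_(d * d) :=
  mxvec (\matrix_(i, j) (op_fun T (riesz s (e i)) : dual s) (e j)).
have gP : linear g.
  move=> c S T; rewrite -linearP; congr mxvec; apply/matrixP => i j.
  by rewrite !mxE op_funP; exact: dual_funP.
pose gl : {linear operator u -> 'rV[R]_(d * d)} :=
  HB.pack g (GRing.isLinear.Build R (operator u) 'rV[R]_(d * d) _ g gP).
apply: (@finite_dimensional_inj _ _ _ gl) => S T /(can_inj mxvecK)/matrixP ST.
have STe i : op_fun S (riesz s (e i)) = op_fun T (riesz s (e i)).
  apply: dual_ext => y; have [c ->] := e_span y; rewrite !dual_sumr.
  by apply: eq_bigr => j _; rewrite !dualZ; have := ST i j; rewrite !mxE => ->.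
have STr x : op_fun S (riesz s x) = op_fun T (riesz s x).
  have [c ->] := e_span x; rewrite !linear_sum.
  by apply: eq_bigr => i _; rewrite !linearZ /= STe.
have eval_adj (U : operator u) f y : (op_fun U f : dual s) y
    = hilbert_semi (dual_hilbert s) f (op_adj U (riesz s y)).
  by rewrite -op_adjP; apply/esym/dual_inner_riesz.
have adj_eval (U : operator u) y x : (op_adj U (riesz s y) : dual s) x
    = hilbert_semi (dual_hilbert s) (op_fun U (riesz s x)) (riesz s y).
  by rewrite op_adjP semi_formC; apply/esym/dual_inner_riesz.
have adjE y : op_adj S (riesz s y) = op_adj T (riesz s y).
  by apply: dual_ext => x; rewrite !adj_eval STr.
apply: op_ext => f; apply: dual_ext => y.
by rewrite !eval_adj adjE.
Qed.

(** A separate name for the carrier, so that real scalars act on it while [A] keeps its complex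
    ones. *)
Definition realify (R : realType) (A : complexStarAlgType R) : Type := A.

(** * The real GNS construction *)

Section Realify.
Variables (R : realType) (A : complexStarAlgType R).
Local Notation RA := (realify A).

HB.instance Definition _ := GRing.Zmodule.on RA.

Definition realify_scale (r : R) (x : RA) : RA := (r%:C *: (x : A)).

Lemma realify_scalerA a b x :
  realify_scale a (realify_scale b x) = realify_scale (a * b) x.
Proof. by rewrite /realify_scale scalerA rmorphM. Qed.

Lemma realify_scale1r : left_id 1 realify_scale.
Proof. by move=> x; rewrite /realify_scale rmorph1 scale1r. Qed.

Lemma realify_scalerDr : right_distributive realify_scale +%R.
Proof. by move=> a x y; rewrite /realify_scale scalerDr. Qed.

Lemma realify_scalerDl x : {morph realify_scale^~ x : a b / a + b}.
Proof. by move=> a b; rewrite /realify_scale rmorphD scalerDl. Qed.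

HB.instance Definition _ := GRing.Zmodule_isLmodule.Build R RA
  realify_scalerA realify_scale1r realify_scalerDr realify_scalerDl.

Lemma realify_finite_dimensional :
  finite_dimensional A -> finite_dimensional RA.
Proof.
move=> [d [e e_span]]; exists (d + d)%N.
exists (fun i : 'I_(d + d) => match fintype.split i with
  | inl j => e j : RA | inr j => ('i%C *: e j : A) : RA end).
move=> x; have [c ->] := e_span x.
exists (fun i : 'I_(d + d) => match fintype.split i with
  | inl j => complex.Re (c j) | inr j => complex.Im (c j) end).
rewrite big_split_ord /= -big_split /=; apply: eq_bigr => j _.
rewrite -[lshift d j]/(unsplit (inl j)) -[rshift d j]/(unsplit (inr j)).
rewrite !unsplitK.
by rewrite {1}[c j]complexE scalerDl [X in _ + X *: _]mulrC -scalerA.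
Qed.

Lemma star1 : star (1 : A) = 1.
Proof. by have := starM (star (1 : A)) 1; rewrite mulr1 starK mulr1. Qed.

Variable phi : {scalar A}.
Hypothesis phi_state : is_state phi.

Definition state_form (x y : RA) : R :=
  complex.Re (phi (star (y : A) * (x : A))).

(** Positivity makes [phi] real on [star z * z]. For [z = x + i y] the imaginary part is the
    difference of the two sides, up to the vanishing terms of [x] and [y] alone. *)
Lemma state_formC x y : state_form x y = state_form y x.
Proof.
have [_ phi_pos] := phi_state.
have Im0 (z : A) : complex.Im (phi (star z * z)) = 0 by apply: ger0_Im.
have := Im0 ((x : A) + 'i%C *: (y : A)); rewrite /state_form.
rewrite starD starZ !(mulrDl, mulrDr) -!scalerAl -!scalerAr.
rewrite !linearD !linearZ /=.
have -> : Num.conj 'i%C = - 'i%C :> R[i] by rewrite complexiE conjCi.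
have /= := Im0 x; have /= := Im0 y.
case: (phi _) => a b /= ->.
case: (phi _) => a1 b1. case: (phi _) => a2 b2. case: (phi _) => a3 b3 /= ->.
lra.
Qed.

Lemma state_formP c x y z :
  state_form (c *: x + y) z = c * state_form x z + state_form y z.
Proof.
rewrite /state_form mulrDr -scalerAr linearD linearZ /=.
by case: (phi _) => a b; case: (phi _) => a' b' /=; rewrite mul0r subr0.
Qed.

Lemma state_form_ge0 x : 0 <= state_form x x.
Proof.
have [_ /(_ x)] := phi_state.
by rewrite lecE /= => /andP[].
Qed.

Definition state_semi : semi_inner RA :=
  SemiInner state_formC state_formP state_form_ge0.

Lemma projection_sym_idem (p : A) : is_projection p ->
  symmetric_idempotent state_semi (fun x : RA => p * (x : A) : RA).
Proof.
move=> [p_star pp]; split=> [c x y|x y|x].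
- by rewrite mulrDr -scalerAr.
- by rewrite /= /state_form starM p_star mulrA.
- by rewrite mulrA pp.
Qed.

Lemma cyclic_neq0 : (riesz state_semi (1 : A) : dual_hilbert state_semi) != 0.
Proof.
apply/eqP => /(congr1 (fun f : dual state_semi => `|f| ^+ 2)).
rewrite norm_riesz normr0 expr0n /= /state_form star1 mulr1.
by have [-> _] := phi_state => /eqP; rewrite oner_eq0.
Qed.

(** The image of the unit of [A]: it defines the vector state and is also the nonzero vector that
    [operator] asks for. *)
Definition cyclic : {f : dual_hilbert state_semi | f != 0} := 
  exist (fun f : dual_hilbert state_semi => f != 0) _ cyclic_neq0.

Local Notation xi := (sval cyclic).

Definition vector_state (T : operator cyclic) : R :=
  hilbert_semi (dual_hilbert state_semi) (op_fun T xi) xi.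

Lemma vector_state_scalar : scalar vector_state.
Proof. by move=> c S T; rewrite /vector_state op_funP semi_formP. Qed.

HB.instance Definition _ := GRing.isLinear.Build R (operator cyclic) R *%R
  vector_state vector_state_scalar.

Lemma vector_state_real : is_real_state vector_state.
Proof.
split; [split|] => [|T|T].
- rewrite /vector_state /= [LHS]dual_inner_norm norm_riesz /= /state_form.
  by rewrite star1 mulr1; have [-> _] := phi_state.
- rewrite [leRHS]semi_formC; have := op_adjP T xi (op_fun T xi).
  by move=> <-; exact: semi_form_ge0.
- change (vector_state (adjoint_op T) = vector_state T).
  by rewrite /vector_state [RHS]op_adjP semi_formC.
Qed.

End Realify.

Lemma complex_to_real (R : realType) (n m k : nat) (A : complexStarAlgType R)
    (p : correlation R n m k) :
  complex_realizes A p ->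
  exists B : realStarAlgType R,
    [/\ is_real_cstar B, finite_dimensional A -> finite_dimensional B
      & real_realizes B p].
Proof.
move=> [P [phi [[P_proj P_sum P_comm] phi_state pE]]].
exists (operator (cyclic phi_state)); split.
- exact: operator_real_cstar.
- move=> A_fin; apply: operator_finite_dimensional.
  exact: realify_finite_dimensional.
pose Psym i b a := projection_sym_idem phi_state (P_proj i b a).
pose Q i b a := lift_op (Psym i b a) (cyclic phi_state).
exists Q, (@vector_state R A phi phi_state : {scalar _}); split; last 1 first.
- move=> a b.
  (* On the image of [riesz] the lifted projections act as left multiplications. *)
  have Q_riesz (x : A) : op_fun (\prod_(i < k) Q i (b i) (a i))
      (riesz (state_semi phi_state) x)
      = riesz (state_semi phi_state) ((\prod_(i < k) P i (b i) (a i)) * x).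
    elim/big_rec2: _ x => [|i y T _ IH] x; first by rewrite mul1r.
    rewrite -[LHS]/(op_fun (Q i (b i) (a i)) (op_fun T _)) IH.
    by rewrite -[LHS]/(dual_comp (Psym i (b i) (a i)) _) dual_comp_riesz mulrA.
  pose xi : dual _ := riesz (state_semi phi_state) (1 : A).
  (* Pairing with [riesz 1] evaluates at 1, which leaves the real part of [phi] at the product, and
     this value of [phi] is already real. *)
  rewrite -[RHS]/(dual_inner (op_fun (\prod_(i < k) Q i (b i) (a i)) xi) xi).
  rewrite Q_riesz mulr1 [RHS]dual_inner_riesz /= state_formC//.
  rewrite /state_form star1 mul1r.
  by rewrite -pE.
- split=> [i b a|i b|i j b b' a a' ij].
  + exact: lift_op_projection.
  + apply: op_ext => f; apply: dual_ext => x.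
    rewrite op_fun_sum dual_suml.
    rewrite -[LHS]/(\sum_(a < n) (f : dual _) (P i b a * x : realify A)).
    by rewrite -dual_sumr -mulr_suml P_sum mul1r.
  + apply: op_ext => f; apply: dual_ext => x.
    (* Operators act on functionals by precomposition, which reverses the order of the factors. *)
    rewrite -[LHS]/((f : dual _) (P j b' a' * (P i b a * x) : realify A)).
    rewrite -[RHS]/((f : dual _) (P i b a * (P j b' a' * x) : realify A)).
    by rewrite !mulrA (P_comm _ _ _ _ _ _ ij).
- exact: vector_state_real.
Qed.

(** * From real to complex *)

(* [(x, y)] stands for [x + i y]. *)
Definition complexify (R : realType) (A : realStarAlgType R) : Type :=
  (A * A)%type.

(** * The complexification as a complex star-algebra *)

Section Complexify.
Variables (R : realType) (A : realStarAlgType R).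
Local Notation CA := (complexify A).

HB.instance Definition _ := GRing.Zmodule.copy CA (A * A)%type.

Implicit Types (x y : A) (z w : CA).

Lemma complexifyD z w : z + w = (z.1 + w.1, z.2 + w.2) :> CA.
Proof. by []. Qed.

Definition cmul z w : CA := (z.1 * w.1 - z.2 * w.2, z.1 * w.2 + z.2 * w.1).

Lemma cmulA : associative cmul.
Proof.
move=> [x1 x2] [y1 y2] [z1 z2]; rewrite /cmul /=.
rewrite !mulrBl !mulrDl !mulrBr !mulrDr !mulrA !opprD.
by congr pair; rewrite !addrA [RHS](ACl (1*3*4*2)%AC).
Qed.

Lemma cmul1 : left_id (1 : A, 0 : A) cmul.
Proof. by move=> [x y]; rewrite /cmul /= !mul1r !mul0r subr0 addr0. Qed.

Lemma cmulr1 : right_id (1 : A, 0 : A) cmul.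
Proof. by move=> [x y]; rewrite /cmul /= !mulr1 !mulr0 subr0 add0r. Qed.

Lemma cmulDl : left_distributive cmul +%R.
Proof.
move=> [x1 x2] [y1 y2] [z1 z2]; rewrite /cmul complexifyD /= !mulrDl.
by congr pair; rewrite ?opprD addrACA.
Qed.

Lemma cmulDr : right_distributive cmul +%R.
Proof.
move=> [x1 x2] [y1 y2] [z1 z2]; rewrite /cmul complexifyD /= !mulrDr.
by congr pair; rewrite ?opprD addrACA.
Qed.

Lemma complexify1_neq0 : ((1, 0) : CA) != 0.
Proof. by rewrite xpair_eqE oner_eq0. Qed.

HB.instance Definition _ := GRing.Zmodule_isNzRing.Build CA
  cmulA cmul1 cmulr1 cmulDl cmulDr complexify1_neq0.

Definition cscale (c : R[i]) z : CA :=
  (complex.Re c *: z.1 - complex.Im c *: z.2,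
   complex.Re c *: z.2 + complex.Im c *: z.1).

Lemma cscaleA a b z : cscale a (cscale b z) = cscale (a * b) z.
Proof.
case: a b z => [a1 a2] [b1 b2] [x y]; rewrite /cscale /=.
rewrite !scalerBr !scalerDr !scalerA !scalerBl !scalerDl !opprD.
by congr pair; rewrite !addrA [RHS](ACl (1*3*4*2)%AC).
Qed.

Lemma cscale1 : left_id 1 cscale.
Proof. by case=> x y; rewrite /cscale /= !scale1r !scale0r subr0 addr0. Qed.

Lemma cscaleDr : right_distributive cscale +%R.
Proof.
move=> c [x1 x2] [y1 y2]; rewrite /cscale complexifyD /= !scalerDr.
by congr pair; rewrite ?opprD addrACA.
Qed.

Lemma cscaleDl z : {morph cscale^~ z : a b / a + b}.
Proof.
move=> [a1 a2] [b1 b2]; rewrite /cscale complexifyD /= !scalerDl.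
by congr pair; rewrite ?opprD addrACA.
Qed.

HB.instance Definition _ := GRing.Zmodule_isLmodule.Build R[i] CA
  cscaleA cscale1 cscaleDr cscaleDl.

Lemma cscalerAl (c : R[i]) z w : c *: (z * w) = (c *: z) * w.
Proof.
case: c z w => [a b] [x1 x2] [y1 y2].
congr pair;
  rewrite /= ?mulrDl ?mulNr ?scalerBr ?scalerDr -?scalerAl ?opprD !addrA.
  by rewrite [RHS](ACl (1*3*4*2)%AC).
by rewrite [RHS](ACl (1*3*4*2)%AC).
Qed.

HB.instance Definition _ := GRing.Lmodule_isLalgebra.Build R[i] CA cscalerAl.

Lemma cscalerAr (c : R[i]) z w : c *: (z * w) = z * (c *: w).
Proof.
case: c z w => [a b] [x1 x2] [y1 y2].
congr pair;
  rewrite /= ?mulrDr ?mulrN ?scalerBr ?scalerDr -?scalerAr ?opprD !addrA.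
  by rewrite [RHS](ACl (1*3*2*4)%AC).
by rewrite [RHS](ACl (1*3*2*4)%AC).
Qed.

HB.instance Definition _ := GRing.Lalgebra_isAlgebra.Build R[i] CA cscalerAr.

Definition cstar z : CA := (star z.1, - star z.2).

Lemma star0 : star (0 : A) = 0.
Proof. by have := starZ 0 (0 : A); rewrite scale0r scale0r. Qed.

Lemma starN x : star (- x) = - star x.
Proof. by rewrite -scaleN1r starZ scaleN1r. Qed.

Lemma cstarK : involutive cstar.
Proof. by case=> x y; rewrite /cstar /= starN !starK opprK. Qed.

Lemma cstarD : {morph cstar : z w / z + w}.
Proof.
by move=> [x1 x2] [y1 y2]; rewrite /cstar complexifyD /= !starD opprD.
Qed.

Lemma cstarZ (c : R[i]) z : cstar (c *: z) = Num.conj c *: cstar z.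
Proof.
case: c z => [a b] [x y]; congr pair; rewrite /= !starD ?starN !starZ /=.
  by rewrite scalerN opprK scaleNr.
by rewrite scalerN scaleNr opprD.
Qed.

Lemma cstarM z w : cstar (z * w) = cstar w * cstar z.
Proof.
case: z w => [x1 x2] [y1 y2]; congr pair; rewrite /= !starD ?starN !starM.
  by rewrite mulrNN.
by rewrite mulrN mulNr opprD addrC.
Qed.

HB.instance Definition _ := Algebra_isStar.Build R[i] Num.conj CA
  cstarK cstarD cstarZ cstarM.

End Complexify.

(** * The C*-norm of the complexification, from its action on [H + iH] *)

Section ComplexOperatorNorm.
Variables (R : realType) (A : realStarAlgType R) (H : realHilbert R).
Variables (pi : A -> {linear H -> H}) (pi_alg : closed_operator_algebra pi).
Local Notation CA := (complexify A).
Local Notation HC := (H * H)%type.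

(** The real part of the complex inner product of [H + iH], which induces the same norm. *)
Definition pair_form (xi eta : HC) : R := '[xi.1, eta.1] + '[xi.2, eta.2].

Lemma pair_formC xi eta : pair_form xi eta = pair_form eta xi.
Proof. by rewrite /pair_form semi_formC ['[xi.2, _]]semi_formC. Qed.

Lemma pair_formP c xi eta zeta :
  pair_form (c *: xi + eta) zeta = c * pair_form xi zeta + pair_form eta zeta.
Proof.
by rewrite /pair_form !semi_formDl !semi_formZl /= mulrDr addrACA.
Qed.

Lemma pair_form_ge0 xi : 0 <= pair_form xi xi.
Proof. by rewrite addr_ge0 ?semi_form_ge0. Qed.

Definition pair_semi : semi_inner HC :=
  SemiInner pair_formC pair_formP pair_form_ge0.

Lemma pair_formE (x x' y y' : H) :
  pair_semi (x, x') (y, y') = '[x, y] + '[x', y'].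
Proof. by []. Qed.

Local Notation q := (seminorm pair_semi).

Lemma pair_seminormE xi : q xi = Num.sqrt (`|xi.1| ^+ 2 + `|xi.2| ^+ 2).
Proof.
by rewrite /seminorm /= /pair_form -!seminorm_sqr !hilbert_normE.
Qed.

Lemma pair_seminorm0 (x : H) : q (x, 0) = `|x|.
Proof. by rewrite pair_seminormE /= normr0 expr0n addr0 sqrtr_sqr normr_id. Qed.

(** The product [(x + i y)(h1 + i h2)] expanded into components. *)
Definition act (z : CA) (xi : HC) : HC :=
  (pi z.1 xi.1 - pi z.2 xi.2, pi z.1 xi.2 + pi z.2 xi.1).

Lemma piD x y h : pi (x + y) h = pi x h + pi y h.
Proof. by have := op_linear pi_alg 1 x y h; rewrite !scale1r. Qed.

Lemma pi0 h : pi 0 h = 0.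
Proof. by apply: (addrI (pi 0 h)); rewrite -piD !addr0. Qed.

Lemma piZ c x h : pi (c *: x) h = c *: pi x h.
Proof. by have := op_linear pi_alg c x 0 h; rewrite pi0 !addr0. Qed.

Lemma piN x h : pi (- x) h = - pi x h.
Proof. by rewrite -scaleN1r piZ scaleN1r. Qed.

Lemma piB x y h : pi (x - y) h = pi x h - pi y h.
Proof. by rewrite piD piN. Qed.

Lemma actD z w xi : act (z + w) xi = act z xi + act w xi.
Proof.
rewrite /act complexifyD /= !piD; congr pair => /=; last by rewrite addrACA.
by rewrite opprD addrACA.
Qed.

Lemma actM z w xi : act (z * w) xi = act z (act w xi).
Proof.
rewrite /act /= !piB !piD !(op_mul pi_alg) !linearB !linearD /=.
congr pair; rewrite ?opprD !addrA.
  by rewrite [RHS](ACl (1*4*2*3)%AC).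
by rewrite [RHS](ACl (1*4*2*3)%AC).
Qed.

Lemma act_star z xi eta :
  pair_semi (act z xi) eta = pair_semi xi (act (star z) eta).
Proof.
have adj x h h' : '[pi x h, h'] = '[h, pi (star x) h'].
  exact: op_star pi_alg _ _ _.
rewrite -[LHS]/('[pi z.1 xi.1 - pi z.2 xi.2, eta.1] +
                '[pi z.1 xi.2 + pi z.2 xi.1, eta.2]).
rewrite -[RHS]/('[xi.1, pi (star z.1) eta.1 - pi (- star z.2) eta.2] +
                '[xi.2, pi (star z.1) eta.2 + pi (- star z.2) eta.1]).
rewrite !piN !(semi_formDl, semi_formNl) !adj.
rewrite !(semi_formDr, semi_formNr) opprK; ring.
Qed.

Lemma actZ c z xi : act (c *: z) xi =
  (complex.Re c *: (act z xi).1 - complex.Im c *: (act z xi).2,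
   complex.Re c *: (act z xi).2 + complex.Im c *: (act z xi).1).
Proof.
case: c z => [a b] [x y]; rewrite /act /= !piB !piD !piZ.
rewrite !(scalerBr, scalerDr) !opprD; congr pair; rewrite !addrA.
  by rewrite [LHS](ACl (1*3*4*2)%AC).
by rewrite [LHS](ACl (1*3*4*2)%AC).
Qed.

(** This is multiplication by the scalar [a + i b]; the cross terms cancel by symmetry of the inner
    product. *)
Lemma pair_seminorm_rotate (a b : R) (x y : H) :
  q (a *: x - b *: y, a *: y + b *: x) =
  Num.sqrt (a ^+ 2 + b ^+ 2) * q (x, y).
Proof.
rewrite /seminorm -sqrtrM ?addr_ge0 ?sqr_ge0//; congr Num.sqrt.
rewrite !pair_formE !(semi_formDl, semi_formNl, semi_formZl).
rewrite !(semi_formDr, semi_formNr, semi_formZr).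
rewrite (semi_formC _ y x); ring.
Qed.

Lemma pair_seminorm_le (C : R) (xi eta : HC) : 0 <= C ->
  `|xi.1| <= C * `|eta.1| -> `|xi.2| <= C * `|eta.2| -> q xi <= C * q eta.
Proof.
move=> C0 le1 le2; rewrite !pair_seminormE -[C]ger0_norm// -sqrtr_sqr.
rewrite -sqrtrM ?sqr_ge0//; apply: ler_wsqrtr; rewrite mulrDr -!exprMn.
by rewrite lerD// ler_sqr ?nnegrE ?mulr_ge0.
Qed.

Lemma act_bound x y (C D : R) : 0 <= C -> 0 <= D ->
    (forall h, `|pi x h| <= C * `|h|) -> (forall h, `|pi y h| <= D * `|h|) ->
  bounded_by (fun xi => q (act (x, y) xi)) q (C + D).
Proof.
move=> C0 D0 xC yD; split=> [|[h1 h2]]; first exact: addr_ge0.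
(* The second summand is [y] applied after the quarter turn [(h1, h2) |-> (- h2, h1)], which
   preserves [q]. *)
have -> : act (x, y) (h1, h2) = (pi x h1, pi x h2) + (- pi y h2, pi y h1).
  by [].
rewrite (le_trans (seminormD _ _ _))// mulrDl lerD//.
  by apply: pair_seminorm_le => //=.
have -> : q (h1, h2) = q (h2, h1) by rewrite !pair_seminormE addrC.
by apply: pair_seminorm_le => //=; rewrite normrN.
Qed.

Lemma pi_bounded x : exists2 C, 0 <= C & forall h, `|pi x h| <= C * `|h|.
Proof.
have /(_ 0)/continuous_linear_bounded/linear_boundedP :=
  op_bounded pi_alg (a := x).
by move=> /pinfty_ex_gt0[C C0 xC]; exists C => //; exact: ltW.
Qed.

Lemma act_bounded z : exists C, bounded_by (fun xi => q (act z xi)) q C.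
Proof.
case: z => x y; have [C C0 xC] := pi_bounded x; have [D D0 yD] := pi_bounded y.
by exists (C + D); exact: act_bound.
Qed.

Definition op_norm (z : CA) : R := best_constant (fun xi => q (act z xi)) q.

Lemma op_normP z xi : q (act z xi) <= op_norm z * q xi.
Proof. exact: best_constantP (seminorm_ge0 _) (act_bounded z) xi. Qed.

Lemma op_norm_ge0 z : 0 <= op_norm z.
Proof. exact: best_constant_ge0 (act_bounded z). Qed.

Lemma op_norm_le z C : 0 <= C -> (forall xi, q (act z xi) <= C * q xi) ->
  op_norm z <= C.
Proof. by move=> C0 zC; apply: best_constant_le. Qed.

(** On [(h, 0)] the element [z] acts as [(pi z.1 h, pi z.2 h)]. This reduces definiteness and
    completeness of [op_norm] to the two components. *)
Lemma op_norm_components z h :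
  `|pi z.1 h| <= op_norm z * `|h| /\ `|pi z.2 h| <= op_norm z * `|h|.
Proof.
have := op_normP z (h, 0).
rewrite /act /= !linear0 addr0 add0r pair_seminorm0 pair_seminormE /=.
have le_l (a b : R) : 0 <= a -> a <= Num.sqrt (a ^+ 2 + b ^+ 2).
  move=> a0; rewrite -{1}[a]ger0_norm// -sqrtr_sqr ler_wsqrtr// lerDl.
  exact: sqr_ge0.
move=> N_ge; split; apply: le_trans N_ge; first exact: le_l.
by rewrite addrC; exact: le_l.
Qed.

Lemma op_norm_eq0 z : op_norm z = 0 -> z = 0.
Proof.
move=> z0; rewrite [z]surjective_pairing; congr pair.
  apply: (op_inj pi_alg) => h; have [+ _] := op_norm_components z h.
  by rewrite z0 mul0r normr_le0 pi0 => /eqP.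
apply: (op_inj pi_alg) => h; have [_] := op_norm_components z h.
by rewrite z0 mul0r normr_le0 pi0 => /eqP.
Qed.

Lemma op_normD z w : op_norm (z + w) <= op_norm z + op_norm w.
Proof.
apply: op_norm_le => [|xi]; first by rewrite addr_ge0 ?op_norm_ge0.
by rewrite actD (le_trans (seminormD _ _ _))// mulrDl lerD ?op_normP.
Qed.

Lemma op_normM z w : op_norm (z * w) <= op_norm z * op_norm w.
Proof.
apply: op_norm_le => [|xi]; first by rewrite mulr_ge0 ?op_norm_ge0.
rewrite actM (le_trans (op_normP _ _))// -mulrA ler_wpM2l ?op_norm_ge0//.
exact: op_normP.
Qed.

Lemma op_normZ_le c z :
  op_norm (c *: z) <=
  Num.sqrt (complex.Re c ^+ 2 + complex.Im c ^+ 2) * op_norm z.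
Proof.
apply: op_norm_le => [|xi]; first by rewrite mulr_ge0 ?sqrtr_ge0 ?op_norm_ge0.
rewrite actZ pair_seminorm_rotate -surjective_pairing -mulrA.
by rewrite ler_wpM2l ?sqrtr_ge0 ?op_normP.
Qed.

Lemma op_normZ c z : (op_norm (c *: z))%:C = `|c| * (op_norm z)%:C.
Proof.
have le_normZ d w : (op_norm (d *: w))%:C <= `|d| * (op_norm w)%:C.
  by rewrite normc_def -rmorphM lecR op_normZ_le.
apply/eqP; rewrite eq_le le_normZ /=.
have [->|c0] := eqVneq c 0; first by rewrite normr0 mul0r lecR op_norm_ge0.
have := le_normZ c^-1 (c *: z).
by rewrite scalerA mulVf// scale1r normfV ler_pdivlMl ?normr_gt0.
Qed.

(** [|z xi|^2] is the pairing of [xi] with [star z * z] applied to [xi]; Cauchy-Schwarz bounds it by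
    [op_norm (star z * z) * |xi|^2]. *)
Lemma op_norm_sqr_le z : op_norm z ^+ 2 <= op_norm (star z * z).
Proof.
rewrite -[leRHS]sqr_sqrtr ?op_norm_ge0//.
rewrite ler_sqr ?nnegrE ?sqrtr_ge0 ?op_norm_ge0//.
apply: op_norm_le => [|xi]; first exact: sqrtr_ge0.
rewrite -ler_sqr ?nnegrE ?mulr_ge0 ?sqrtr_ge0 ?seminorm_ge0//.
rewrite exprMn !seminorm_sqr sqr_sqrtr ?op_norm_ge0//.
rewrite act_star -actM -seminorm_sqr expr2 mulrA mulrC.
rewrite (le_trans (ler_norm _))// semi_formC.
rewrite (le_trans (semi_cauchy_schwarz _ _ _))// ler_wpM2l ?seminorm_ge0//.
exact: op_normP.
Qed.

(** Cancel one factor in [|z|^2 <= |star z * z| <= |star z| |z|]. *)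
Lemma op_norm_star_le z : op_norm z <= op_norm (star z).
Proof.
have [->|z0] := eqVneq (op_norm z) 0; first exact: op_norm_ge0.
have := le_trans (op_norm_sqr_le z) (op_normM _ _).
by rewrite expr2 ler_pM2r// lt_def z0 op_norm_ge0.
Qed.

Lemma op_norm_starM z : op_norm (star z * z) = op_norm z ^+ 2.
Proof.
apply/eqP; rewrite eq_le op_norm_sqr_le andbT expr2.
rewrite (le_trans (op_normM _ _))// ler_wpM2r ?op_norm_ge0//.
by rewrite -{2}[z]starK op_norm_star_le.
Qed.

(** The operators [pi (x n)] converge pointwise to a linear map, the convergence is uniform on
    bounded sets, so the limit is bounded and lies in the image of [pi] by [op_closed]. *)
Lemma pi_complete (x : nat -> A) :
    (forall e : R, 0 < e -> exists n0 : nat, forall i j : nat,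
       (n0 <= i)%N -> (n0 <= j)%N ->
       forall h, `|pi (x i - x j) h| <= e * `|h|) ->
  exists a : A, forall e : R, 0 < e -> exists n0 : nat, forall i : nat,
    (n0 <= i)%N -> forall h, `|pi (x i - a) h| <= e * `|h|.
Proof.
move=> x_cauchy.
have x_cvg h : cvg (pi (x n) h @[n --> \oo]).
  apply/cauchy_cvgP/cauchyP => e e0.
  have h1 : 0 < `|h| + 1 by rewrite ltr_wpDl.
  have [n0 xn0] := x_cauchy (e / (`|h| + 1)) (divr_gt0 e0 h1).
  exists (pi (x n0) h); exists n0 => // n /= n0n.
  rewrite -ball_normE /= -piB (le_lt_trans (xn0 _ _ _ _ _))//.
  by rewrite mulrAC ltr_pdivrMr// ltr_pM2l// ltrDl.
pose T h := lim (pi (x n) h @[n --> \oo]).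
have TP h : pi (x n) h @[n --> \oo] --> T h by exact: x_cvg.
have T_linear : linear T.
  move=> c h1 h2; apply/cvg_lim => //.
  under eq_fun do rewrite linearP.
  by apply: cvgD => //; apply: cvgZr.
pose Tl : {linear H -> H} :=
  HB.pack T (GRing.isLinear.Build R H H _ T T_linear).
have T_close (e : R) : 0 < e -> exists n0 : nat, forall i : nat,
    (n0 <= i)%N -> forall h, `|Tl h - pi (x i) h| <= e * `|h|.
  move=> /x_cauchy[n0 xn0]; exists n0 => i n0i h.
  have Th : `|pi (x n) h - pi (x i) h| @[n --> \oo] --> `|Tl h - pi (x i) h|.
    by apply: cvg_norm; apply: cvgB; [exact: TP|exact: cvg_cst].
  apply: (cvgr_to_le Th); exists n0 => // n /= n0n.
  by rewrite -piB xn0.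
have T_cont : continuous Tl.
  have [n0 xn0] := T_close 1 ltr01; have [C C0 xC] := pi_bounded (x n0).
  apply: bounded_linear_continuous; apply/linear_boundedP.
  near=> r => h; rewrite (@le_trans _ _ ((1 + C) * `|h|))//.
    rewrite -(subrK (pi (x n0) h) (Tl h)) (le_trans (ler_normD _ _))//.
    by rewrite mulrDl lerD// xn0.
  by rewrite ler_wpM2r//.
have [|a aT] := op_closed pi_alg T_cont.
  by move=> e /T_close[n0 xn0]; exists (x n0); exact: xn0.
exists a => e /T_close[n0 xn0]; exists n0 => i n0i h.
by rewrite piB aT distrC xn0.
Unshelve. all: by end_near. Qed.

Lemma complexify_cstar : is_cstar CA.
Proof.
exists op_norm; split.
- exact: op_norm_eq0.
- exact: op_normD.
- exact: op_normZ.
- exact: op_normM.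
- exact: op_norm_starM.
move=> u u_cauchy.
have [|x xP] := pi_complete (x := fun n => (u n).1).
  move=> e /u_cauchy[n0 un0]; exists n0 => i j n0i n0j h.
  have [+ _] := op_norm_components (u i - u j) h.
  move=> /le_trans; apply; rewrite ler_wpM2r//; apply: ltW.
  exact: un0.
have [|y yP] := pi_complete (x := fun n => (u n).2).
  move=> e /u_cauchy[n0 un0]; exists n0 => i j n0i n0j h.
  have [_] := op_norm_components (u i - u j) h.
  move=> /le_trans; apply; rewrite ler_wpM2r//; apply: ltW.
  exact: un0.
(* Each component contributes a non-strict [e / 3], so the total stays strictly below [e]. *)
exists (x, y) => e e0; have e3 : 0 < e / 3 by rewrite divr_gt0.
have [n1 xn1] := xP _ e3; have [n2 yn2] := yP _ e3.
exists (maxn n1 n2) => i; rewrite geq_max => /andP[n1i n2i].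
apply: (@le_lt_trans _ _ (e / 3 + e / 3)); last lra.
have [ee0 ee] := act_bound (ltW e3) (ltW e3) (xn1 _ n1i) (yn2 _ n2i).
exact: op_norm_le ee0 ee.
Qed.

End ComplexOperatorNorm.

(** * Extending projections and states to the complexification *)

Section ComplexifyState.
Variables (R : realType) (A : realStarAlgType R).
Local Notation CA := (complexify A).

Lemma complexify_finite_dimensional :
  finite_dimensional A -> finite_dimensional CA.
Proof.
move=> [d [e e_span]]; exists d, (fun i => (e i, 0) : CA) => -[x y].
have [a ->] := e_span x; have [b ->] := e_span y.
exists (fun i => a i +i* b i).
elim/big_rec3: _ => // i u v w _ <-.
by congr pair; rewrite /= scaler0 ?subr0 ?add0r.
Qed.

Definition of_real (x : A) : CA := (x, 0).

Lemma of_real_prod k (x : 'I_k -> A) :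
  \prod_(i < k) of_real (x i) = of_real (\prod_(i < k) x i).
Proof.
elim/big_rec2: _ => // i u v _ ->.
by congr pair; rewrite /= ?mulr0 ?mul0r ?subr0 ?addr0.
Qed.

Lemma of_real_sum n (x : 'I_n -> A) :
  \sum_(i < n) of_real (x i) = of_real (\sum_(i < n) x i).
Proof.
elim/big_rec2: _ => // i u v _ ->.
by congr pair; rewrite /= addr0.
Qed.

Lemma of_realM x y : of_real x * of_real y = of_real (x * y).
Proof. by congr pair; rewrite /= ?mulr0 ?mul0r ?subr0 ?addr0. Qed.

Lemma of_real_pvms n m k (P : 'I_k -> 'I_m -> 'I_n -> A) :
  commuting_pvms P -> commuting_pvms (fun i b a => of_real (P i b a)).
Proof.
move=> [P_proj P_sum P_comm]; split=> [i b a|i b|i j b b' a a' ij].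
- have [P_star PP] := P_proj i b a; split; last by rewrite of_realM PP.
  by congr pair; rewrite /= ?P_star ?star0 ?oppr0.
- by rewrite of_real_sum P_sum.
- by rewrite !of_realM P_comm.
Qed.

Variables (phi : {scalar A}).

Definition complexify_state (z : CA) : R[i] := phi z.1 +i* phi z.2.

Lemma complexify_state_scalar : scalar complexify_state.
Proof.
move=> [a b] [x1 x2] [y1 y2]; rewrite /complexify_state /=.
rewrite !linearD linearN !linearZ /= [b *: - _]mulrN.
by apply/eqP; rewrite eq_complex /= !eqxx.
Qed.

HB.instance Definition _ := GRing.isLinear.Build R[i] CA R[i] *%R
  complexify_state complexify_state_scalar.

(** At [z = x + i y], the value on [star z * z] has real part [phi (star x * x) + phi (star y * y)].
    Its imaginary part [phi (star x * y) - phi (star y * x)] vanishes because [phi] is invariant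
    under [star]. *)
Lemma complexify_state_is_state :
  is_real_state phi -> is_state complexify_state.
Proof.
move=> [[phi1 phi_pos] phi_star]; split.
  by rewrite -[LHS]/(phi 1 +i* phi 0) phi1 linear0.
move=> [x y]; rewrite lecE /= !mulNr opprK !linearD linearN.
rewrite addr_ge0 ?phi_pos// andbT.
by rewrite -(phi_star (star y * x)) starM starK subrr.
Qed.

End ComplexifyState.

Lemma real_to_complex (R : realType) (n m k : nat) (A : realStarAlgType R)
    (p : correlation R n m k) :
  real_realizes A p -> complex_realizes (complexify A) p.
Proof.
move=> [P [phi [P_pvm phi_state pE]]].
exists (fun i b a => of_real (P i b a)), (complexify_state phi : {scalar _}).
split=> [||a b]; first exact: of_real_pvms.
  exact: complexify_state_is_state.
by rewrite of_real_prod pE /= /complexify_state /= linear0.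
Qed.

Theorem corollary13p6 (R : realType) (n m k : nat) :
  CqcR R n m k = Cqc R n m k /\ CqR R n m k = Cq R n m k.
Proof.
split; apply/seteqP; split=> p [p_ge0].
- move=> [A [[H [pi pi_alg]] A_p]]; split=> //; exists (complexify A).
  by split; [exact: complexify_cstar pi_alg|exact: real_to_complex].
- move=> [A [_ /complex_to_real[B [B_cstar _ B_p]]]].
  by split=> //; exists B.
- move=> [A [[H [pi pi_alg]] A_fin A_p]]; split=> //; exists (complexify A).
  split; first exact: complexify_cstar pi_alg.
    exact: complexify_finite_dimensional.
  exact: real_to_complex.
- move=> [A [_ A_fin /complex_to_real[B [B_cstar B_fin B_p]]]].
  by split=> //; exists B; split=> //; exact: B_fin.
Qed.
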